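(* Let $(M,\eta)$ be an $n$-dimensional Lorentzian spacetime, $A_{max}>0$ a constant, and let $x:I\to M$ be a curve such that the tangent vector to its lift at the point ${}^1x=(x,\dot x)\in J^1_0(M)$ is $T=(\dot x,\ddot x)$ and such that $\eta(\dot x,\dot x)\ne0$. Then there is a non-degenerate, symmetric bilinear form $g$, obtained from the isometric embedding of the curve into $(TM,g_S)$ (via its lift), whose action on the tangent vector $\dot x$ (so that $g(\dot x,\dot x)=g_S(T,T)$) is given by the components $$g_{\mu\nu}(x(\tau))=\Big(1+\frac{\eta\big(D_{\dot x}\dot x(\tau),D_{\dot x}\dot x(\tau)\big)}{A^2_{max}\,\eta(\dot x,\dot x)}\Big)\,\eta_{\mu\nu}.$$
   Context: $D$ is the Levi-Civita connection of $\eta$ with Christoffel symbols $\gamma^\mu{}_{\nu\rho}$, and $D_{\dot x}\dot x$ has components $\ddot x^\mu+\gamma^\mu{}_{\nu\rho}(x)\dot x^\nu\dot x^\rho$. With $(x^\mu,y^\mu)$ the natural coordinates on $TM$, $N^\mu{}_\nu(x,y)=\gamma^\mu{}_{\nu\rho}(x)y^\rho$ and $\delta y^\mu=dy^\mu+N^\mu{}_\nu dx^\nu$. $NC\subset TM$ is the bundle of null vectors of $\eta$. On $TM\setminus NC$ the Sasaki-type metric is $$g_S=\eta_{\mu\nu}\,dx^\mu\otimes dx^\nu+\frac{1}{A^2_{max}}\,\eta_{\mu\nu}\,\delta y^\mu\otimes\delta y^\nu .$$ $J^1_0(M)$ is identified with $TM$.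
   Formalization: Non-degeneracy of g is asserted only where g_S(T,T) ≠ 0: for a timelike curve of constant proper acceleration A_max in Minkowski space the displayed components all vanish although η(ẋ,ẋ) ≠ 0. *)

(* Defs.v *)
From HB Require Import structures.
From mathcomp Require Import all_boot all_order all_algebra.
From mathcomp Require Import all_classical all_reals all_analysis.

Set Implicit Arguments.
Unset Strict Implicit.
Unset Printing Implicit Defensive.

Import Order.TTheory GRing.Theory Num.Theory numFieldNormedType.Exports.
Local Open Scope classical_set_scope.
Local Open Scope ring_scope.

Definition partial (R : realType) (n : nat) (i : 'I_n) (f : 'rV[R]_n -> R) :
  'rV[R]_n -> R := fun u => 'D_(delta_mx 0 i) f u.

Definition iter_partial (R : realType) (n : nat) (s : seq 'I_n)
  (f : 'rV[R]_n -> R) : 'rV[R]_n -> R := foldr (@partial R n) f s.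

(* C^oo on U (meant for open U): partial derivatives of every order exist and
   are differentiable, hence continuous, at every point of U. *)
Definition smooth_on (R : realType) (n : nat) (U : set 'rV[R]_n)
  (f : 'rV[R]_n -> R) : Prop :=
  forall (s : seq 'I_n) (u : 'rV[R]_n), U u -> differentiable (iter_partial s f) u.

(* Smooth n-manifold with an atlas indexed by [chart].  [chart_map c] and
   [chart_inv c] are total functions, but only meaningful on the open sets
   [chart_dom c] and [chart_map c @` chart_dom c], between which they are inverse
   homeomorphisms. *)
Record manifold (R : realType) (n : nat) := Manifold {
  carrier :> topologicalType ;
  chart : Type ;
  chart_dom : chart -> set carrier ;
  chart_map : chart -> carrier -> 'rV[R]_n ;
  chart_inv : chart -> 'rV[R]_n -> carrier ;
  manifold_hausdorff : hausdorff_space carrier ;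
  manifold_second_countable : @second_countable carrier ;
  dom_cover : forall p, exists c, chart_dom c p ;
  dom_open : forall c, open (chart_dom c) ;
  image_open : forall c, open (chart_map c @` chart_dom c) ;
  chart_mapK : forall c p, chart_dom c p -> chart_inv c (chart_map c p) = p ;
  chart_map_continuous : forall c, {within chart_dom c, continuous (chart_map c)} ;
  chart_inv_continuous : forall c,
    {within chart_map c @` chart_dom c, continuous (chart_inv c)} ;
  transition_smooth : forall (c d : chart) (k : 'I_n),
    smooth_on (chart_map c @` (chart_dom c `&` chart_dom d))
      (fun u => chart_map d (chart_inv c u) 0 k)
}.

Arguments chart_dom {R n m} c.
Arguments chart_map {R n m} c.
Arguments chart_inv {R n m} c.

(* [(transition_jacobian c d p) i j] is the derivative of the j-th coordinate
   of d with respect to the i-th coordinate of c; components of vectors are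
   rows, and change from c to d by right multiplication with this matrix. *)
Definition transition_jacobian (R : realType) (n : nat) (M : manifold R n)
  (c d : chart M) (p : M) : 'M[R]_n :=
  'J (fun u : 'rV[R]_n => chart_map d (chart_inv c u)) (chart_map c p).

(* A bilinear form on the tangent space at p, given by its matrix of components
   in each chart around p (values in the other charts are irrelevant). *)
Definition bilinear_form_at (R : realType) (n : nat) (M : manifold R n) (p : M)
  (B : chart M -> 'M[R]_n) : Prop :=
  forall c d : chart M, chart_dom c p -> chart_dom d p ->
    B c = transition_jacobian c d p *m B d *m (transition_jacobian c d p)^T.

Definition bform (R : realType) (n : nat) (B : 'M[R]_n) (u v : 'rV[R]_n) : R :=
  \sum_(i < n) \sum_(j < n) B i j * u 0 i * v 0 j.

Definition is_symmetric_form (R : realType) (n : nat) (B : 'M[R]_n) : Prop :=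
  forall u v, bform B u v = bform B v u.

Definition is_nondegenerate_form (R : realType) (n : nat) (B : 'M[R]_n) : Prop :=
  forall u, (forall v, bform B u v = 0) -> u = 0.

(* Signature (-,+,...,+): there is a basis, the rows of P, in which the
   components are diag(-1,1,...,1). *)
Definition is_lorentzian_form (R : realType) (n : nat) (B : 'M[R]_n) : Prop :=
  exists2 P : 'M[R]_n, P \in unitmx &
    forall a b : 'I_n, bform B (row a P) (row b P) =
      if a == b then (if a == 0%N :> nat then -1 else 1) else 0.

(* [metric_comp eta c] are the components in the chart c, as functions of the
   coordinates of c. *)
Record lorentzian_metric (R : realType) (n : nat) (M : manifold R n) :=
  LorentzianMetric {
    metric_comp : chart M -> 'rV[R]_n -> 'M[R]_n ;
    metric_smooth : forall (c : chart M) (i j : 'I_n),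
      smooth_on (chart_map c @` chart_dom c) (fun u => metric_comp c u i j) ;
    metric_tensor : forall p : M,
      bilinear_form_at p (fun c => metric_comp c (chart_map c p)) ;
    metric_symmetric : forall (c : chart M) (p : M), chart_dom c p ->
      is_symmetric_form (metric_comp c (chart_map c p)) ;
    metric_lorentzian : forall (c : chart M) (p : M), chart_dom c p ->
      is_lorentzian_form (metric_comp c (chart_map c p))
  }.

(* [christoffel eta c u mu nu rho] has mu as upper index. *)
Definition christoffel (R : realType) (n : nat) (M : manifold R n)
  (eta : lorentzian_metric M) (c : chart M) (u : 'rV[R]_n)
  (mu nu rho : 'I_n) : R :=
  let G := metric_comp eta c in
  2^-1 * \sum_(s < n) invmx (G u) mu s *
    (partial nu (fun w => G w s rho) u + partial rho (fun w => G w s nu) u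
     - partial s (fun w => G w nu rho) u).

(* Points of TM are given in the natural coordinates (u, y) induced by a chart
   c, and tangent vectors of TM by their components (X, Y) along (dx, dy). *)

Definition nonlinear_connection (R : realType) (n : nat) (M : manifold R n)
  (eta : lorentzian_metric M) (c : chart M) (u y : 'rV[R]_n) : 'M[R]_n :=
  \matrix_(mu, nu) \sum_(rho < n) christoffel eta c u mu nu rho * y 0 rho.

Definition delta_y (R : realType) (n : nat) (M : manifold R n)
  (eta : lorentzian_metric M) (c : chart M) (uy : 'rV[R]_n * 'rV[R]_n)
  (XY : 'rV[R]_n * 'rV[R]_n) : 'rV[R]_n :=
  \row_mu (XY.2 0 mu +
    \sum_(nu < n) nonlinear_connection eta c uy.1 uy.2 mu nu * XY.1 0 nu).

(* The Sasaki-type metric on TM minus the null bundle (the formula makes sense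
   at every point of TM). *)
Definition sasaki (R : realType) (n : nat) (M : manifold R n)
  (eta : lorentzian_metric M) (Amax : R) (c : chart M)
  (uy : 'rV[R]_n * 'rV[R]_n) (V W : 'rV[R]_n * 'rV[R]_n) : R :=
  bform (metric_comp eta c uy.1) V.1 W.1 +
  (Amax ^+ 2)^-1 *
    bform (metric_comp eta c uy.1) (delta_y eta c uy V) (delta_y eta c uy W).

Definition position (R : realType) (n : nat) (M : manifold R n) (c : chart M)
  (x : R -> M) : R -> 'rV[R]_n := fun t => chart_map c (x t).

Definition velocity (R : realType) (n : nat) (M : manifold R n) (c : chart M)
  (x : R -> M) : R -> 'rV[R]_n := derive1 (position c x).

Definition acceleration (R : realType) (n : nat) (M : manifold R n)
  (c : chart M) (x : R -> M) : R -> 'rV[R]_n := derive1 (velocity c x).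

Definition curve_lift (R : realType) (n : nat) (M : manifold R n) (c : chart M)
  (x : R -> M) : R -> 'rV[R]_n * 'rV[R]_n :=
  fun t => (position c x t, velocity c x t).

Definition covariant_acceleration (R : realType) (n : nat) (M : manifold R n)
  (eta : lorentzian_metric M) (c : chart M) (x : R -> M) (t : R) : 'rV[R]_n :=
  \row_mu (acceleration c x t 0 mu +
    \sum_(nu < n) \sum_(rho < n) christoffel eta c (position c x t) mu nu rho *
      velocity c x t 0 nu * velocity c x t 0 rho).

Definition metric_along (R : realType) (n : nat) (M : manifold R n)
  (eta : lorentzian_metric M) (c : chart M) (x : R -> M) (t : R) : 'M[R]_n :=
  metric_comp eta c (position c x t).

(* The metric gS(T,T) dt^2 induced on the parameter interval by the lift with
   tangent vector T is nondegenerate at t.  An isometric embedding of an interval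
   carrying a pseudo-Riemannian metric satisfies this at every t, and it can fail
   off the null bundle: gS(T,T) vanishes on a timelike curve of constant
   acceleration Amax in Minkowski space. *)
Definition induces_metric_at (R : realType) (n : nat) (M : manifold R n)
  (eta : lorentzian_metric M) (Amax : R) (c : chart M) (x : R -> M) (t : R)
  (T : 'rV[R]_n * 'rV[R]_n) : Prop :=
  sasaki eta Amax c (curve_lift c x t) T T != 0.

(* Main.v *)
(** In each chart put [g = k h] with [k = 1 + h(a,a) / (Amax^2 h(v,v))], where
    [a] is the covariant acceleration.  Along the lift, [delta y (T) = a], so that
    [g(v,v) = h(v,v) + h(a,a) / Amax^2 = gS(T,T)], and [g] is nondegenerate as
    soon as this is nonzero.  The chart independence of [k] amounts to the
    tensoriality of [a].  Lowering its index gives, for every vector [w],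
      [h(w,a) = h(w, x'') + (D_v h)(w,v) - (D_w h)(v,v) / 2],
    which contains no inverse of [h].  Differentiating [h_c = J (h_d o f) J^T] for a
    transition map [f] with Jacobian [J], the non-tensorial terms of this
    expression cancel because second partial derivatives of [f] commute. *)

Require Import Defs.
From mathcomp Require Import all_boot all_order all_algebra.
From mathcomp Require Import all_classical all_reals all_analysis.
From mathcomp Require Import ring lra.

Import Order.TTheory GRing.Theory Num.Theory numFieldNormedType.Exports.
Local Open Scope classical_set_scope.
Local Open Scope ring_scope.

(** * Symmetry of second directional derivatives *)

Lemma is_derive_line {R : realType} {V W : normedModType R} (f : V -> W)
    (u v : V) (s : R) (df : W) :
  is_derive s 1 (fun r : R => f (u + r *: v)) df <->
  is_derive (u + s *: v) v f df.
Proof.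
have E : (fun h : R => h^-1 *: (f (u + (h *: 1 + s) *: v) - f (u + s *: v))) =
         (fun h => h^-1 *: (f (h *: v + (u + s *: v)) - f (u + s *: v))).
  by apply/funext => h; rewrite [h%:A]mulr1 scalerDl addrCA.
split=> -[]; rewrite /derivable /derive => dfv <-; split.
- by rewrite /derivable -E.
- by rewrite /derive -E.
- by rewrite /derivable E.
- by rewrite /derive E.
Qed.

Definition second_difference {R : realType} {V : normedModType R} (f : V -> R)
    (u v w : V) : R :=
  f (u + v + w) - f (u + v) - f (u + w) + f u.

Lemma second_differenceC {R : realType} {V : normedModType R} (f : V -> R)
    (u v w : V) : second_difference f u v w = second_difference f u w v.
Proof. by rewrite /second_difference -[u + v + w]addrA [v + w]addrC addrA; ring. Qed.

(* Mean value theorem for [s |-> f (u + h w + s v) - f (u + s v)] on [0, h]. *)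
Lemma second_difference_derive {R : realType} {V : normedModType R} (f : V -> R)
    (u v w : V) :
  (\forall z \near u, differentiable f z) -> differentiable ('D_v f) u ->
  forall e, 0 < e -> \forall h \near (0 : R)^'+,
    `|second_difference f u (h *: v) (h *: w) - h ^+ 2 * 'D_w ('D_v f) u|
    <= e * h ^+ 2.
Proof.
move=> df dA e e0.
set A := 'D_v f.
(* [h * K] bounds the norm of every [s v + p w] with [s], [p] in [[0, h]]. [K] also absorbs the two
   errors of the expansion of [A], whose arguments have total norm at most [h (2 |v| + |w|)]. The
   summand 1 keeps [K] positive when [v = w = 0]. *)
have K0 : 0 < 2 * `|v| + `|w| + 1 by rewrite ltr_wpDl// addr_ge0// mulr_ge0.
set K := 2 * `|v| + `|w| + 1 in K0.
have /diff_locally/eqaddoP/(_ (e / K)) := dA.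
rewrite divr_gt0// => /(_ isT) H.
have {df H} : \forall z \near (0 : V), differentiable f (u + z) /\
    `|A (u + z) - (A u + 'd A u z)| <= e / K * `|z|.
  move: df; rewrite (near_shift 0) subr0 /= => df.
  near=> z; split.
    by rewrite addrC; near: z.
  by rewrite [u + z]addrC; near: z; exact: H.
move=> /nbhs_norm0P[r /= r0 Hr].
have dK : \forall h \near (0 : R)^'+, h * K < r.
  near=> h; rewrite -ltr_pdivlMr//; near: h.
  by apply: nbhs_right_lt; rewrite divr_gt0.
near=> h.
have h0 : 0 < h by near: h; exact: nbhs_right_gt.
have hK : h * K < r by near: h; exact: dK.
have in_ball s p : 0 <= s <= h -> 0 <= p <= h -> `|s *: v + p *: w| < r.
  move=> /andP[s0 sh] /andP[p0 ph]; apply: le_lt_trans hK.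
  rewrite (le_trans (ler_normD _ _))// !normrZ (ger0_norm s0) (ger0_norm p0).
  have : s * `|v| <= h * `|v| by rewrite ler_wpM2r.
  have : p * `|w| <= h * `|w| by rewrite ler_wpM2r.
  have : 0 <= h * `|v| by rewrite mulr_ge0// ltW.
  by rewrite /K; lra.
pose F s := f (u + h *: w + s *: v) - f (u + s *: v).
have dF s : 0 <= s <= h ->
    is_derive s 1 F (A (u + h *: w + s *: v) - A (u + s *: v)).
  move=> sh; apply: is_deriveB; apply/is_derive_line/derivableP/diff_derivable.
    rewrite -addrA [_ *: w + _]addrC.
    by apply: (Hr _ _).1 => /=; apply: in_ball => //; rewrite ltW//= lexx.
  apply: (Hr _ _).1 => /=; rewrite -[_ *: v]addr0 -(scale0r w).
  by apply: in_ball => //; rewrite lexx ltW.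
have [|||c ch] := @MVT R F (fun s => A (u + h *: w + s *: v) - A (u + s *: v)) 0 h.
- by [].
- by move=> s; rewrite in_itv/= => /andP[? ?]; apply: dF; rewrite !ltW.
- apply: derivable_within_continuous => s; rewrite in_itv/= => sh.
  by have [] := dF s sh.
rewrite subr0 => FE.
have {}FE : second_difference f u (h *: v) (h *: w) =
    (A (u + (c *: v + h *: w)) - A (u + c *: v)) * h.
  rewrite addrA [u + c *: v + _]addrAC -FE /F /second_difference scale0r !addr0.
  by rewrite [u + h *: w + _]addrAC; ring.
have {}ch : 0 <= c <= h by move: ch; rewrite in_itv/= => /andP[? ?]; rewrite !ltW.
have H1 := (Hr (c *: v + h *: w) (in_ball _ _ ch _)).2.
have H2 : `|A (u + c *: v) - (A u + 'd A u (c *: v))| <= e / K * `|c *: v|.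
  apply: (Hr _ _).2 => /=; rewrite -[_ *: v]addr0 -(scale0r w).
  by apply: in_ball => //; rewrite lexx ltW.
have {}H1 := H1 _; rewrite lexx (ltW h0) in H1; have {}H1 := H1 isT.
rewrite FE deriveE//.
(* Both values of [A] given by the mean value theorem are expanded at [u]. The unknown point [c]
   enters through the same term ['d A u (c v)] in both, so it cancels and [h * 'd A u w] is left. *)
have L : 'd A u (c *: v + h *: w) = 'd A u (c *: v) + h * 'd A u w.
  by rewrite linearD; congr (_ + _); exact: linearZ.
move: H1 H2; rewrite L.
set a1 := A (u + (_ + _)); set a2 := A (u + _); set a0 := A u.
set d1 := diff _ _ (c *: v); set d2 := diff _ _ w => H1 H2.
have -> : (a1 - a2) * h - h ^+ 2 * d2 =
   h * ((a1 - (a0 + (d1 + h * d2))) - (a2 - (a0 + d1))).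
  by ring.
rewrite normrM (gtr0_norm h0) expr2 mulrCA ler_pM2l//.
rewrite (le_trans (ler_normB _ _))// (le_trans (lerD H1 H2))// -mulrDr.
rewrite -mulrA ler_pM2l// mulrC ler_pdivrMr//.
have n1 := ler_normD (c *: v) (h *: w).
move: n1; rewrite !normrZ (gtr0_norm h0) => n1.
have [c0 chh] := andP ch; move: n1; rewrite (ger0_norm c0) => n1.
have : c * `|v| <= h * `|v| by rewrite ler_wpM2r.
by rewrite /K; lra.
Unshelve. all: by end_near. Qed.

(** At a common small [h > 0] the two estimates give [h^2 |a - b| <= e h^2], for every [e > 0]. *)
Lemma quadratic_coef_unique {R : realType} (S : R -> R) (a b : R) :
  (forall e, 0 < e -> \forall h \near 0^'+, `|S h - h ^+ 2 * a| <= e * h ^+ 2) ->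
  (forall e, 0 < e -> \forall h \near 0^'+, `|S h - h ^+ 2 * b| <= e * h ^+ 2) ->
  a = b.
Proof.
move=> Sa Sb; apply/eqP; rewrite -subr_eq0 -normr_le0.
apply/ler_addgt0Pr => e e0; have e20 : 0 < e / 2 by rewrite divr_gt0.
near (0 : R)^'+ => h.
have h20 : 0 < h ^+ 2 by rewrite exprn_gt0//; near: h; exact: nbhs_right_gt.
have ha : `|S h - h ^+ 2 * a| <= e / 2 * h ^+ 2 by near: h; exact: Sa.
have hb : `|S h - h ^+ 2 * b| <= e / 2 * h ^+ 2 by near: h; exact: Sb.
rewrite add0r -(ler_pM2l h20).
have -> : h ^+ 2 * `|a - b| = `|(S h - h ^+ 2 * b) - (S h - h ^+ 2 * a)|.
  by rewrite -[X in X * _](gtr0_norm h20) -normrM; congr `|_|; ring.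
rewrite (le_trans (ler_normB _ _))// (le_trans (lerD hb ha))//.
by rewrite -mulrDl -splitr mulrC.
Unshelve. all: by end_near. Qed.

(** Each iterated derivative is the [h^2] coefficient of one and the same second difference, which
    is symmetric in [v] and [w]. First derivatives differentiable at the single point [u] suffice;
    no continuity of second derivatives enters. *)
Lemma derive_comm {R : realType} {V : normedModType R} (f : V -> R) (u v w : V) :
  (\forall z \near u, differentiable f z) ->
  differentiable ('D_v f) u -> differentiable ('D_w f) u ->
  'D_w ('D_v f) u = 'D_v ('D_w f) u.
Proof.
move=> df dv dw.
apply: (@quadratic_coef_unique R
  (fun h => second_difference f u (h *: v) (h *: w))) => e e0.
  exact: second_difference_derive.
under eq_near do rewrite second_differenceC.
exact: second_difference_derive.
Qed.

(** * Calculus of matrix-valued maps *)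

Lemma is_derive_mxP {R : realType} {V : normedModType R} {m n : nat}
    (A : V -> 'M[R]_(m, n)) (dA : 'M[R]_(m, n)) (x v : V) :
  is_derive x v A dA <->
  forall i j, is_derive x v (fun y => A y i j : R) (dA i j).
Proof.
split=> [[dAx <-] i j | dAx].
  rewrite derive_mx// mxE; apply: derivableP.
  exact: (derivable_mxP _ _ _).1.
have dA' : derivable A x v.
  by apply/derivable_mxP => i j; have [] := dAx i j.
split=> //; rewrite derive_mx//; apply/matrixP => i j; rewrite mxE.
by have [] := dAx i j.
Qed.

Lemma is_derive_trmx {R : realType} {V : normedModType R} {m n : nat}
    (A : V -> 'M[R]_(m, n)) (dA : 'M[R]_(m, n)) (x v : V) :
  is_derive x v A dA -> is_derive x v (fun y => (A y)^T) dA^T.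
Proof.
move=> /is_derive_mxP dAx; apply/is_derive_mxP => i j; rewrite mxE.
by under eq_fun do rewrite mxE; exact: dAx.
Qed.

Lemma is_derive_mulmx {R : realType} {V : normedModType R} {m n p : nat}
    (A : V -> 'M[R]_(m, n)) (B : V -> 'M[R]_(n, p)) dA dB (x v : V) :
  is_derive x v A dA -> is_derive x v B dB ->
  is_derive x v (fun y => A y *m B y) (dA *m B x + A x *m dB).
Proof.
move=> /is_derive_mxP dAx /is_derive_mxP dBx; apply/is_derive_mxP => i k.
rewrite !mxE -big_split/=; under eq_fun do rewrite mxE.
rewrite [X in is_derive _ _ X _](_ : _ =
  \sum_(j < n) (fun y => A y i j * B y j k)); last first.
  by apply/funext => y; rewrite fct_sumE.
apply: is_derive_sum => j.
have dAB := @is_deriveM _ _ _ _ _ _ _ _ (dAx i j) (dBx j k).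
apply: (@is_derive_eq _ _ _ _ _ _ _ _ dAB).
by rewrite addrC; congr (_ + _); rewrite -[RHS]mulrC.
Qed.

Lemma differentiable_mx {R : realType} {V : normedModType R} {m n : nat}
    (A : V -> 'M[R]_(m, n)) (x : V) :
  (forall i j, differentiable (fun y => A y i j : R) x) -> differentiable A x.
Proof.
move=> dA.
have -> : A = \sum_i \sum_j (fun y => A y i j *: delta_mx i j : 'M[R]_(m, n)).
  apply/funext => y; rewrite fct_sumE [LHS]matrix_sum_delta.
  by apply: eq_bigr => i _; rewrite fct_sumE.
apply: differentiable_sum => i; apply: differentiable_sum => j.
exact: differentiableZl.
Qed.

(** Here [g] has a derivative in the direction [v] only. Restricted to the line through [x] along
    [v] it becomes a function of one real variable, for which derivability is differentiability, and
    the chain rule for differentials applies. *)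
Lemma is_derive_comp {R : realType} {U V W : normedModType R} (g : U -> V)
    (f : V -> W) (x v : U) (dg : V) :
  is_derive x v g dg -> differentiable f (g x) ->
  is_derive x v (f \o g) ('D_dg f (g x)).
Proof.
move=> dgx dfg; rewrite -[x]addr0 -(scale0r v); apply/is_derive_line.
rewrite scale0r addr0.
have dgx' : is_derive (x + 0 *: v) v g dg by rewrite scale0r addr0.
have [/derivable1_diffP dc cE] := (is_derive_line g x v 0 dg).2 dgx'.
set c := fun r : R => g (x + r *: v) in dc cE.
have c0 : c 0 = g x by rewrite /c scale0r addr0.
have df' : differentiable f (c 0) by rewrite c0.
rewrite -[fun r => _]/(f \o c); have dfc := differentiable_comp dc df'.
split; first exact/derivable1_diffP.
rewrite deriveE// in cE.
by rewrite [LHS]deriveE// diff_comp// [RHS]deriveE//= cE c0.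
Qed.

(** * Coordinate derivatives, and the lowered acceleration under a change of coordinates *)

Lemma derive_sum_partial {R : realType} {n : nat} (f : 'rV[R]_n -> R)
    (u v : 'rV[R]_n) :
  differentiable f u -> 'D_v f u = \sum_i v 0 i * partial i f u.
Proof.
move=> df; rewrite deriveE// {1}(row_sum_delta v) linear_sum/=.
by apply: eq_bigr => i _; rewrite linearZ /partial deriveE.
Qed.

(** The Euler-Lagrange expression of the energy [G(v,v) / 2] paired with [w], where [a] stands for
    the second derivative of the curve. It is kept as a 1 x 1 matrix so that products can be
    reassociated and transposed. *)
Definition lowered_acceleration {R : realType} {n : nat}
    (G : 'rV[R]_n -> 'M[R]_n) (u v a w : 'rV[R]_n) : 'M[R]_1 :=
  w *m G u *m a^T + w *m 'D_v G u *m v^T - 2^-1 *: (v *m 'D_w G u *m v^T).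

Lemma derive_congruence {R : realType} {n : nat} (f : 'rV[R]_n -> 'rV[R]_n)
    (G H J : 'rV[R]_n -> 'M[R]_n) (u w : 'rV[R]_n) :
  (\forall z \near u, G z = J z *m H (f z) *m (J z)^T) ->
  is_derive u w f (w *m J u) -> differentiable H (f u) -> differentiable J u ->
  'D_w G u = 'D_w J u *m H (f u) *m (J u)^T +
    J u *m 'D_(w *m J u) H (f u) *m (J u)^T + J u *m H (f u) *m ('D_w J u)^T.
Proof.
move=> GE df dH dJ.
have dJw : is_derive u w J ('D_w J u) by apply/derivableP/diff_derivable.
have dHw := is_derive_comp _ _ _ _ _ df dH.
have dK := is_derive_mulmx _ _ _ _ _ _
  (is_derive_mulmx _ _ _ _ _ _ dJw dHw) (is_derive_trmx _ _ _ _ dJw).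
rewrite -mulmxDl -(@derive_val _ _ _ _ _ _ _ dK).
apply: near_eq_derive.
exact: GE.
Qed.

(** This is the algebra of the cancellation. Of the terms containing a derivative of [J],
    [w J H dJv^T v^T] is absorbed into [a J + v dJv]. The remaining one from [dJv] equals, by [comm]
    and the symmetry of [H], each of the two from [dJw]; these carry the factor 1/2 and a minus
    sign, so all three cancel. *)
Lemma congruence_first_variation {R : realType} {n : nat}
    (J H dJv dJw dHv dHw : 'M[R]_n) (v a w : 'rV[R]_n) :
  w *m dJv = v *m dJw -> H^T = H ->
  w *m (J *m H *m J^T) *m a^T
  + w *m (dJv *m H *m J^T + J *m dHv *m J^T + J *m H *m dJv^T) *m v^T
  - 2^-1 *: (v *m (dJw *m H *m J^T + J *m dHw *m J^T + J *m H *m dJw^T) *m v^T)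
  = w *m J *m H *m (a *m J + v *m dJv)^T + w *m J *m dHv *m (v *m J)^T
    - 2^-1 *: (v *m J *m dHw *m (v *m J)^T).
Proof.
move=> comm symH.
rewrite !linearD/= !trmx_mul !(mulmxDl, mulmxDr) !mulmxA -comm.
set X := w *m dJv *m _ *m _ *m _.
set Y := v *m J *m H *m dJw^T *m _.
(* A 1 x 1 matrix equals its transpose. *)
have -> : Y = X.
  rewrite -[Y]trmxK (mx11_scalar Y^T) tr_scalar_mx -mx11_scalar.
  by rewrite !trmx_mul !trmxK symH !mulmxA -comm.
set S := v *m J *m dHw *m _ *m _.
have -> : 2^-1 *: (X + S + X) = X + 2^-1 *: S.
  by rewrite addrAC scalerDr -[X + X]mulr2n -[X *+ 2]scaler_nat scalerA
    mulVf ?scale1r ?pnatr_eq0.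
rewrite opprD addrA; congr (_ - _).
by rewrite -!addrA; congr (_ + _); rewrite [LHS]addrC -!addrA addNr addr0 addrC.
Qed.

(** The relation between [G] and [H] is assumed near [u] because it gets differentiated. The
    argument [a J + v (D_v J)] is the transformation law of a second derivative along a curve. *)
Lemma lowered_acceleration_congruence {R : realType} {n : nat}
    (f : 'rV[R]_n -> 'rV[R]_n) (G H J : 'rV[R]_n -> 'M[R]_n)
    (u v a w : 'rV[R]_n) :
  (\forall z \near u, G z = J z *m H (f z) *m (J z)^T) ->
  (forall x, is_derive u x f (x *m J u)) ->
  differentiable H (f u) -> differentiable J u ->
  w *m 'D_v J u = v *m 'D_w J u -> (H (f u))^T = H (f u) ->
  lowered_acceleration G u v a w =
  lowered_acceleration H (f u) (v *m J u) (a *m J u + v *m 'D_v J u) (w *m J u).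
Proof.
move=> GE df dH dJ comm symH.
have dG x := derive_congruence _ _ _ _ _ x GE (df x) dH dJ.
rewrite /lowered_acceleration !dG (nbhs_singleton GE).
exact: congruence_first_variation.
Qed.

(** * The covariant acceleration with its index lowered *)

Lemma mx_form_sum {R : realType} {n : nat} (B : 'M[R]_n) (v w : 'rV[R]_n) :
  (v *m B *m w^T) 0 0 = \sum_(i < n) \sum_(j < n) B i j * v 0 i * w 0 j.
Proof.
rewrite mxE exchange_big/=; apply: eq_bigr => j _; rewrite !mxE big_distrl/=.
by apply: eq_bigr => i _; rewrite [B i j * _]mulrC.
Qed.

Lemma derive_mx_partial {R : realType} {n p q : nat}
    (G : 'rV[R]_n -> 'M[R]_(p, q)) (u v : 'rV[R]_n) (i : 'I_p) (j : 'I_q) :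
  (forall i j, differentiable (fun z => G z i j : R) u) ->
  'D_v G u i j = \sum_(k < n) v 0 k * partial k (fun z => G z i j) u.
Proof.
move=> dG; rewrite derive_mx; last exact/diff_derivable/differentiable_mx.
by rewrite mxE derive_sum_partial.
Qed.

(** Multiplication by the metric cancels the inverse metric in the Christoffel symbols and leaves
    those of the first kind. Contracted twice with the velocity, their first two terms agree after
    swapping [nu] and [rho] and combine to [D_v G]; the third gives the [D_w G] term. *)
Lemma lower_covariant_acceleration {R : realType} {n : nat} {M : manifold R n}
    (eta : lorentzian_metric M) (c : chart M) (x : R -> M) (t : R)
    (w : 'rV[R]_n) :
  metric_comp eta c (position c x t) \in unitmx ->
  (forall i j, differentiable (fun z => metric_comp eta c z i j) (position c x t)) ->
  w *m metric_comp eta c (position c x t) *m (covariant_acceleration eta c x t)^T =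
  lowered_acceleration (metric_comp eta c) (position c x t) (velocity c x t)
    (acceleration c x t) w.
Proof.
set u := position c x t => unitG dG; set G := metric_comp eta c in unitG dG *.
set v := velocity c x t; set a := acceleration c x t.
(* [P s nu rho] is the derivative of [G_(s rho)] in direction [nu], and [L] collects the Christoffel
   symbols of the first kind contracted with [v] twice. *)
pose P s nu rho := partial nu (fun z => G z s rho) u.
pose L : 'cV[R]_n := \col_s \sum_nu \sum_rho
  2^-1 * (P s nu rho + P s rho nu - P nu s rho) * v 0 nu * v 0 rho.
have -> : (covariant_acceleration eta c x t)^T = a^T + invmx (G u) *m L.
  apply/colP => mu; rewrite !mxE; congr (_ + _).
  under [RHS]eq_bigr do rewrite mxE big_distrr/=.
  rewrite [RHS]exchange_big/=; apply: eq_bigr => nu _.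
  under [RHS]eq_bigr do rewrite big_distrr/=.
  rewrite [RHS]exchange_big/=; apply: eq_bigr => rho _.
  rewrite /christoffel -/u -/v -/G big_distrr/= !big_distrl/=.
  by apply: eq_bigr => s _; rewrite /P; ring.
rewrite mulmxDr mulmxA mulmxK// /lowered_acceleration -addrA; congr (_ + _).
pose S (F : 'I_n -> 'I_n -> 'I_n -> R) :=
  \sum_s \sum_nu \sum_rho w 0 s * F s nu rho * v 0 nu * v 0 rho.
have Dv : (w *m 'D_v G u *m v^T) 0 0 = S P.
  rewrite mx_form_sum; apply: eq_bigr => s _; rewrite exchange_big/=.
  apply: eq_bigr => rho _; rewrite derive_mx_partial// !big_distrl/=.
  by apply: eq_bigr => nu _; rewrite /P; ring.
have Dv' : S P = S (fun s nu rho => P s rho nu).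
  apply: eq_bigr => s _; rewrite exchange_big/=; apply: eq_bigr => rho _.
  by apply: eq_bigr => nu _; ring.
have Dw : (v *m 'D_w G u *m v^T) 0 0 = S (fun s nu rho => P nu s rho).
  rewrite mx_form_sum /S [RHS]exchange_big/=; apply: eq_bigr => nu _.
  rewrite [RHS]exchange_big/=; apply: eq_bigr => rho _.
  rewrite derive_mx_partial// !big_distrl/=.
  by apply: eq_bigr => s _; rewrite /P; ring.
apply/matrixP => i j; rewrite !ord1.
have entryE (A B : 'M[R]_1) (k : R) : (A - k *: B) 0 0 = A 0 0 - k * B 0 0.
  by rewrite !mxE.
rewrite entryE; transitivity (2^-1 * (S P + S (fun s nu rho => P s rho nu))
    - 2^-1 * S (fun s nu rho => P nu s rho)); last first.
  rewrite -Dv'; congr (_ - 2^-1 * _); last exact: esym Dw.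
  by apply: etrans (esym Dv); field.
rewrite -mulrBr /S -!big_split/= -sumrB big_distrr/= mxE.
apply: eq_bigr => s _; rewrite mxE -!big_split/= -sumrB !big_distrr/=.
apply: eq_bigr => nu _; rewrite -!big_split/= -sumrB !big_distrr/=.
by apply: eq_bigr => rho _; ring.
Qed.

(** * Bilinear forms as matrices *)

Lemma bformE {R : realType} {n : nat} (B : 'M[R]_n) (u v : 'rV[R]_n) :
  bform B u v = (u *m B *m v^T) 0 0.
Proof. by rewrite mx_form_sum. Qed.

Lemma bform_delta {R : realType} {n : nat} (B : 'M[R]_n) (i j : 'I_n) :
  bform B (delta_mx 0 i) (delta_mx 0 j) = B i j.
Proof. by rewrite bformE trmx_delta -rowE -colE !mxE. Qed.

Lemma bform_congruence {R : realType} {n : nat} (J B : 'M[R]_n)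
    (u v : 'rV[R]_n) :
  bform (J *m B *m J^T) u v = bform B (u *m J) (v *m J).
Proof. by rewrite !bformE trmx_mul !mulmxA. Qed.

Lemma is_symmetric_formP {R : realType} {n : nat} (B : 'M[R]_n) :
  is_symmetric_form B <-> B^T = B.
Proof.
split=> [symB|symB u v].
  by apply/matrixP => i j; rewrite mxE -!bform_delta symB.
rewrite !bformE -[in RHS]symB.
by rewrite -[in LHS](trmxK (_ *m _)) [LHS]mxE !trmx_mul trmxK mulmxA.
Qed.

Lemma unitmx_nondegenerate {R : realType} {n : nat} (B : 'M[R]_n) :
  B \in unitmx -> is_nondegenerate_form B.
Proof.
move=> unitB u uB0; rewrite -(mulmxK unitB u).
rewrite (_ : u *m B = 0) ?mul0mx//; apply/rowP => j.
by have := uB0 (delta_mx 0 j); rewrite bformE trmx_delta -colE !mxE.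
Qed.

(** [P B P^T] is diagonal with entries 1 and -1, hence invertible, and so is each of its factors. *)
Lemma lorentzian_unitmx {R : realType} {n : nat} (B : 'M[R]_n) :
  is_lorentzian_form B -> B \in unitmx.
Proof.
move=> [P _ PB].
pose D : 'rV[R]_n := \row_a (if a == 0%N :> nat then -1 else 1).
have E : P *m B *m P^T = diag_mx D.
  apply/matrixP => a b; rewrite -(bform_delta (P *m B *m P^T)).
  rewrite bform_congruence -!rowE PB !mxE mulrb.
  by case: eqP.
have : P *m B *m P^T \in unitmx.
  rewrite E unitmxE det_diag unitfE prodf_seq_neq0; apply/allP => a _.
  by rewrite mxE; case: ifP => _; rewrite ?oppr_eq0 oner_eq0.
by rewrite !unitmx_mul => /andP[/andP[]].
Qed.

(** * Transition maps and their Jacobians *)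

Definition transition {R : realType} {n : nat} {M : manifold R n}
    (c d : chart M) (z : 'rV[R]_n) : 'rV[R]_n :=
  chart_map d (chart_inv c z).

Definition overlap {R : realType} {n : nat} {M : manifold R n}
    (c d : chart M) : set 'rV[R]_n :=
  chart_map c @` (chart_dom c `&` chart_dom d).

(** The Jacobian as a function of the coordinates. Its entries are literally partial derivatives
    covered by [transition_smooth], so it can be differentiated again. *)
Definition transition_partials {R : realType} {n : nat} {M : manifold R n}
    (c d : chart M) (z : 'rV[R]_n) : 'M[R]_n :=
  \matrix_(i, k) partial i (fun y => transition c d y 0 k) z.

(** Points near [chart_map c p] lie in the open image of [c], and continuity of [chart_inv c] keeps
    their preimages in the domain of [d]. Openness turns identities on the overlap into identities
    near a point, which may be differentiated. *)
Lemma overlap_open {R : realType} {n : nat} {M : manifold R n}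
    (c d : chart M) : open (overlap c d).
Proof.
have oc : open (chart_map c @` chart_dom c) by exact: image_open.
have cinv z : (chart_map c @` chart_dom c) z -> {for z, continuous (chart_inv c)}.
  have := @chart_inv_continuous _ _ _ c.
  by rewrite continuous_open_subspace// => + Oz; apply; exact: mem_set.
rewrite openE => _ [p [cp dp] <-].
have Op : (chart_map c @` chart_dom c) (chart_map c p) by exists p.
have dn : nbhs (chart_map c p) (chart_inv c @^-1` chart_dom d).
  apply: (cinv _ Op); rewrite chart_mapK//.
  by apply: open_nbhs_nbhs; split=> //; exact: dom_open.
near=> z.
have [q cq qz] : (chart_map c @` chart_dom c) z.
  by near: z; apply: open_nbhs_nbhs.
exists q => //; split => //.
rewrite -(chart_mapK cq) qz.
by near: z.
Unshelve. all: by end_near. Qed.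

Lemma transition_coord_differentiable {R : realType} {n : nat} {M : manifold R n}
    (c d : chart M) z k :
  overlap c d z -> differentiable (fun y => transition c d y 0 k) z.
Proof. exact: (@transition_smooth _ _ _ c d k [::]). Qed.

Lemma transition_partial_differentiable {R : realType} {n : nat} {M : manifold R n}
    (c d : chart M) z i k :
  overlap c d z ->
  differentiable (partial i (fun y => transition c d y 0 k)) z.
Proof. exact: (@transition_smooth _ _ _ c d k [:: i]). Qed.

Lemma transition_differentiable {R : realType} {n : nat} {M : manifold R n}
    (c d : chart M) z : overlap c d z -> differentiable (transition c d) z.
Proof.
move=> Uz; apply: differentiable_mx => i k; rewrite ord1.
exact: transition_coord_differentiable.
Qed.

Lemma transition_jacobianE {R : realType} {n : nat} {M : manifold R n}
    (c d : chart M) p : chart_dom c p -> chart_dom d p ->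
  transition_jacobian c d p = transition_partials c d (chart_map c p).
Proof.
move=> cp dp; have Up : overlap c d (chart_map c p) by exists p.
have df := transition_differentiable _ _ _ Up.
apply/row_matrixP => i; rewrite rowE -deriveEjacobian// derive_mx;
  last exact: diff_derivable.
by apply/rowP => k; rewrite !mxE.
Qed.

Lemma transition_is_derive {R : realType} {n : nat} {M : manifold R n}
    (c d : chart M) z v :
  overlap c d z ->
  is_derive z v (transition c d) (v *m transition_partials c d z).
Proof.
move=> Uz; apply/is_derive_mxP => i k; rewrite ord1.
have df := transition_coord_differentiable _ _ _ k Uz.
split; first exact: diff_derivable.
rewrite derive_sum_partial// mxE.
by apply: eq_bigr => j _; rewrite mxE.
Qed.

Lemma transition_jacobian_differentiable {R : realType} {n : nat} {M : manifold R n}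
    (c d : chart M) z : overlap c d z -> differentiable (transition_partials c d) z.
Proof.
move=> Uz; apply: differentiable_mx => i k.
under eq_fun do rewrite mxE.
exact: transition_partial_differentiable.
Qed.

(** Entrywise, both sides contract the second partials of a transition coordinate with [v] and [w],
    and these partials commute. *)
Lemma transition_jacobian_comm {R : realType} {n : nat} {M : manifold R n}
    (c d : chart M) z v w :
  overlap c d z ->
  w *m 'D_v (transition_partials c d) z = v *m 'D_w (transition_partials c d) z.
Proof.
move=> Uz.
have JD x : 'D_x (transition_partials c d) z =
    \matrix_(i, k) \sum_j x 0 j *
      partial j (partial i (fun y => transition c d y 0 k)) z.
  apply/matrixP => i k; rewrite mxE derive_mx_partial.
    by under eq_bigr do under eq_fun do rewrite mxE.
  move=> {}i {}k; under eq_fun do rewrite mxE.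
  exact: transition_partial_differentiable.
have partialC i j k : partial j (partial i (fun y => transition c d y 0 k)) z =
    partial i (partial j (fun y => transition c d y 0 k)) z.
  apply: derive_comm; [|exact: transition_partial_differentiable..].
  apply: filterS (open_nbhs_nbhs (conj (overlap_open c d) Uz)) => y.
  exact: transition_coord_differentiable.
apply/rowP => k; rewrite !JD !mxE.
under eq_bigr do rewrite mxE big_distrr/=.
rewrite exchange_big/=; apply: eq_bigr => j _; rewrite mxE big_distrr/=.
by apply: eq_bigr => i _; rewrite (partialC i j k) mulrCA.
Qed.

(** * Velocity and acceleration in two charts *)

Lemma is_derive_fst {R : realType} {U V W : normedModType R} (f : U -> V * W)
    (x v : U) (df : V * W) :
  is_derive x v f df -> is_derive x v (fun y => (f y).1) df.1.
Proof.
move=> [fx <-]; set l := 'D_v f x.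
have fl : (fun h => h^-1 *: ((f \o shift x) (h *: v) - f x)) @ 0^' --> l by exact: fx.
have f1 := cvg_comp _ _ fl (@cvg_fst _ _ (nbhs l.1) (nbhs l.2) _).
by split; [apply/cvg_ex; exists l.1 | apply: cvg_lim => //]; exact: f1.
Qed.

Lemma is_derive_snd {R : realType} {U V W : normedModType R} (f : U -> V * W)
    (x v : U) (df : V * W) :
  is_derive x v f df -> is_derive x v (fun y => (f y).2) df.2.
Proof.
move=> [fx <-]; set l := 'D_v f x.
have fl : (fun h => h^-1 *: ((f \o shift x) (h *: v) - f x)) @ 0^' --> l by exact: fx.
have f2 := cvg_comp _ _ fl (@cvg_snd _ _ (nbhs l.1) (nbhs l.2) _).
by split; [apply/cvg_ex; exists l.2 | apply: cvg_lim => //]; exact: f2.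
Qed.

Lemma is_derive_derive1 {R : realType} {V : normedModType R} (f g : R -> V)
    (t : R) (df : V) :
  (\forall s \near t, f s = g s) -> is_derive t 1 g df -> derive1 f t = df.
Proof.
by move=> fg [_ <-]; rewrite derive1E; exact: near_eq_derive.
Qed.

(** By continuity the curve stays in the domain of [c] near [t], so there its position in [d] is the
    transition map applied to its position in [c]; then the chain rule applies. *)
Lemma velocity_transition {R : realType} {n : nat} {M : manifold R n}
    (c d : chart M) (x : R -> M) (t : R) :
  {for t, continuous x} -> chart_dom c (x t) -> chart_dom d (x t) ->
  is_derive t 1 (position c x) (velocity c x t) ->
  velocity d x t = velocity c x t *m transition_partials c d (position c x t).
Proof.
move=> xt ct dt dpos.
have Ut : overlap c d (position c x t) by exists (x t).
apply: (@is_derive_derive1 _ _ _ (transition c d \o position c x)).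
  have : nbhs t (x @^-1` chart_dom c).
    by apply: xt; apply: open_nbhs_nbhs; split=> //; exact: dom_open.
  by apply: filterS => s cs; rewrite /position /transition/= chart_mapK.
have [_ <-] := transition_is_derive c d _ (velocity c x t) Ut.
by apply: is_derive_comp; last exact: transition_differentiable.
Qed.

(** Product rule for the velocity law, which must therefore hold near [t]; the non-tensorial term is
    the derivative of [J] along the curve. *)
Lemma acceleration_transition {R : realType} {n : nat} {M : manifold R n}
    (c d : chart M) (x : R -> M) (t : R) :
  let J := transition_partials c d in
  let v := velocity c x t in
  overlap c d (position c x t) ->
  (\forall s \near t, velocity d x s = velocity c x s *m J (position c x s)) ->
  is_derive t 1 (position c x) v ->
  is_derive t 1 (velocity c x) (acceleration c x t) ->
  acceleration d x t = acceleration c x t *m J (position c x t) +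
    v *m 'D_v J (position c x t).
Proof.
move=> J v Ut nearv dpos dvel.
apply: (is_derive_derive1 _ _ _ _ nearv).
have dJ := is_derive_comp _ _ _ _ _ dpos
  (transition_jacobian_differentiable c d _ Ut).
exact: (is_derive_mulmx _ _ _ _ _ _ dvel dJ).
Qed.

Lemma metric_transition {R : realType} {n : nat} {M : manifold R n}
    (eta : lorentzian_metric M) (c d : chart M) (z : 'rV[R]_n) :
  overlap c d z ->
  metric_comp eta c z = transition_partials c d z *m
    metric_comp eta d (transition c d z) *m (transition_partials c d z)^T.
Proof.
move=> [p [cp dp] <-].
by rewrite (metric_tensor eta cp dp) transition_jacobianE// /transition chart_mapK.
Qed.

Lemma covariant_acceleration_transition {R : realType} {n : nat}
    {M : manifold R n} (eta : lorentzian_metric M) (c d : chart M) (x : R -> M)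
    (t : R) :
  chart_dom c (x t) -> chart_dom d (x t) ->
  (\forall s \near t, velocity d x s =
    velocity c x s *m transition_partials c d (position c x s)) ->
  is_derive t 1 (position c x) (velocity c x t) ->
  is_derive t 1 (velocity c x) (acceleration c x t) ->
  covariant_acceleration eta d x t =
  covariant_acceleration eta c x t *m transition_partials c d (position c x t).
Proof.
move=> ct dt nearv dpos dvel.
have Ut : overlap c d (position c x t) by exists (x t).
have fu : transition c d (position c x t) = position d x t.
  by rewrite /transition /position chart_mapK.
have GE := metric_transition eta _ _ _ Ut; rewrite fu in GE.
have unitG e : chart_dom e (x t) -> metric_comp eta e (position e x t) \in unitmx.
  by move=> et; exact/lorentzian_unitmx/metric_lorentzian.
have dG e : chart_dom e (x t) -> forall i j,
    differentiable (fun z => metric_comp eta e z i j) (position e x t).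
  by move=> et i j; apply: (@metric_smooth _ _ _ eta e i j [::]); exists (x t).
have lowE (w : 'rV[R]_n) : w *m metric_comp eta c (position c x t)
      *m (covariant_acceleration eta c x t)^T =
    w *m transition_partials c d (position c x t)
      *m metric_comp eta d (position d x t) *m (covariant_acceleration eta d x t)^T.
  rewrite (lower_covariant_acceleration _ _ _ _ _ (unitG c ct) (dG c ct)).
  rewrite (lower_covariant_acceleration _ _ _ _ _ (unitG d dt) (dG d dt)).
  rewrite (acceleration_transition _ _ _ _ Ut nearv dpos dvel) (nbhs_singleton nearv) -fu.
  apply: lowered_acceleration_congruence.
  - apply: filterS (open_nbhs_nbhs (conj (overlap_open c d) Ut)) => z.
    exact: metric_transition.
  - by move=> v; exact: transition_is_derive.
  - by rewrite fu; apply: differentiable_mx; exact: dG.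
  - exact: transition_jacobian_differentiable.
  - exact: transition_jacobian_comm.
  - by rewrite fu; apply/is_symmetric_formP/metric_symmetric.
(* It remains to undo the lowering. As [G_c = Jt G_d Jt^T] is invertible, so is its factor [Jt G_d],
   which can be cancelled from [Jt G_d Jt^T a_c^T = Jt G_d a_d^T]. The latter is [lowE] tested on
   the basis vectors. *)
set Jt := transition_partials c d (position c x t) in GE lowE *.
have unitJG : Jt *m metric_comp eta d (position d x t) \in unitmx.
  by have := unitG c ct; rewrite GE unitmx_mul => /andP[].
apply: trmx_inj; rewrite trmx_mul; apply: (can_inj (mulKmx unitJG)).
rewrite (mulmxA _ Jt^T) -GE; apply/row_matrixP => i.
by have := lowE (delta_mx 0 i); rewrite -!mulmxA !rowE.
Qed.

(** * The Sasaki-type metric along the lift, and the induced form *)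

Lemma delta_y_curve_lift {R : realType} {n : nat} {M : manifold R n}
    (eta : lorentzian_metric M) (c : chart M) (x : R -> M) (t : R) :
  delta_y eta c (curve_lift c x t) (velocity c x t, acceleration c x t) =
  covariant_acceleration eta c x t.
Proof.
apply/rowP => mu; rewrite !mxE/=; congr (_ + _).
apply: eq_bigr => nu _; rewrite !mxE big_distrl/=.
by apply: eq_bigr => rho _; ring.
Qed.

Theorem theorem3p5 (R : realType) (n : nat) (M : manifold R n)
  (eta : lorentzian_metric M) (Amax : R) (I : set R) (x : R -> M)
  (T : chart M -> R -> 'rV[R]_n * 'rV[R]_n)
  (Amax_gt0 : 0 < Amax)
  (I_open : open I) (I_interval : is_interval I)
  (x_continuous : forall t, I t -> {for t, continuous x})
  (T_def : forall c t, T c t = (velocity c x t, acceleration c x t))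
  (T_tangent : forall c t, I t -> chart_dom c (x t) ->
     is_derive t 1 (curve_lift c x) (T c t))
  (x_nonnull : forall c t, I t -> chart_dom c (x t) ->
     bform (metric_along eta c x t) (velocity c x t) (velocity c x t) != 0) :
  exists g : R -> chart M -> 'M[R]_n,
    (forall t, I t -> bilinear_form_at (x t) (g t)) /\
    (forall c t, I t -> chart_dom c (x t) ->
      let h := metric_along eta c x t in
      let v := velocity c x t in
      let a := covariant_acceleration eta c x t in
      let gS := sasaki eta Amax c (curve_lift c x t) in
      [/\ is_symmetric_form (g t c),
          induces_metric_at eta Amax c x t (T c t) -> is_nondegenerate_form (g t c),
          bform (g t c) v v = gS (T c t) (T c t) &
          forall mu nu : 'I_n,
            g t c mu nu =
            (1 + bform h a a / (Amax ^+ 2 * bform h v v)) * h mu nu]).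
Proof.
pose factor t c := 1 +
  bform (metric_along eta c x t) (covariant_acceleration eta c x t)
    (covariant_acceleration eta c x t) /
  (Amax ^+ 2 * bform (metric_along eta c x t) (velocity c x t) (velocity c x t)).
have A0 : Amax != 0 by rewrite gt_eqF.
(* [derive1] is a total function; tangency of [T] is what makes velocity and acceleration genuine
   derivatives. *)
have dpos c t : I t -> chart_dom c (x t) ->
    is_derive t 1 (position c x) (velocity c x t).
  by move=> It ct; have := is_derive_fst _ _ _ _ (T_tangent c t It ct); rewrite T_def.
have dvel c t : I t -> chart_dom c (x t) ->
    is_derive t 1 (velocity c x) (acceleration c x t).
  by move=> It ct; have := is_derive_snd _ _ _ _ (T_tangent c t It ct); rewrite T_def.
exists (fun t c => factor t c *: metric_along eta c x t); split.
  move=> t It c d ct dt.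
  have near_dom e : chart_dom e (x t) -> \forall s \near t, chart_dom e (x s).
    move=> et; apply: (x_continuous t It).
    by apply: open_nbhs_nbhs; split=> //; exact: dom_open.
  (* The velocity law is established on a whole neighbourhood of [t], since the acceleration law
     differentiates it. *)
  have near_vel : \forall s \near t, velocity d x s =
      velocity c x s *m transition_partials c d (position c x s).
    apply: filterS3 (open_nbhs_nbhs (conj I_open It)) (near_dom c ct) (near_dom d dt).
    move=> s Is cs ds.
    exact: (velocity_transition _ _ _ _ (x_continuous s Is) cs ds (dpos c s Is cs)).
  have aE := covariant_acceleration_transition eta c d x t ct dt near_vel
    (dpos c t It ct) (dvel c t It ct).
  have vE := nbhs_singleton near_vel.
  have hE : metric_along eta c x t = transition_jacobian c d (x t) *m
      metric_along eta d x t *m (transition_jacobian c d (x t))^T.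
    exact: metric_tensor.
  (* Numerator and denominator are separately invariant, because [a] and [v] both transform as
     vectors. *)
  have factor_congruence (J hc hd : 'M[R]_n) (ac ad vc vd : 'rV[R]_n) :
      hc = J *m hd *m J^T -> ad = ac *m J -> vd = vc *m J ->
      1 + bform hc ac ac / (Amax ^+ 2 * bform hc vc vc) =
      1 + bform hd ad ad / (Amax ^+ 2 * bform hd vd vd).
    by move=> -> -> ->; rewrite !bform_congruence.
  have factorE : factor t c = factor t d.
    have tJ := transition_jacobianE c d _ ct dt.
    by apply: factor_congruence; [exact: hE | rewrite tJ; exact: aE | rewrite tJ; exact: vE].
  by rewrite factorE hE scalemxAl scalemxAr.
move=> c t It ct h v a gS.
have bformZ k (u w : 'rV[R]_n) : bform (k *: h) u w = k * bform h u w.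
  by rewrite !bformE -scalemxAr -scalemxAl mxE.
have hv0 : bform h v v != 0 by exact: x_nonnull.
have gSE : factor t c * bform h v v = gS (T c t) (T c t).
  rewrite /gS /sasaki T_def delta_y_curve_lift/= -/(metric_along eta c x t) -/h.
  by rewrite -/v -/a /factor -/h -/v -/a; field; rewrite hv0 A0.
split.
- by move=> u w; rewrite !bformZ metric_symmetric.
(* By [gSE], nonvanishing of [gS(T,T)] forces the conformal factor to be nonzero, and a nonzero
   multiple of an invertible matrix is invertible. *)
- rewrite /induces_metric_at -/gS -gSE mulf_eq0 negb_or => /andP[k0 _].
  apply: unitmx_nondegenerate; rewrite unitmxZ ?unitfE//.
  exact/lorentzian_unitmx/metric_lorentzian.
- by rewrite bformZ.
- by move=> mu nu; rewrite mxE.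
Qed.
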